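(* For every integer $n\ge1$, the generating function of even-order OSASMs satisfies \[ X^{\mathrm O}_{2n}(r,t)=t^{2n+2}\,X^{\mathrm O}_{2n}(r,t^{-1}) \] as Laurent polynomials in the indeterminates $r,t$.
   Context: An alternating sign matrix (ASM) is a square matrix with entries in $\{-1,0,1\}$ such that in each row and each column the nonzero entries alternate in sign and sum to $1$. A diagonally symmetric ASM (DSASM) is a symmetric ASM. An off-diagonally symmetric ASM (OSASM) of even order is a DSASM of even order all of whose diagonal entries are $0$; $\mathrm{OSASM}(2n)$ denotes the set of these of order $2n$. For such $A$, $R(A)=\sum_{1\le i<j\le 2n}|A_{i,j}|$ and $T(A)$ is the column index of the unique $1$ in the first row of $A$. Define $X^{\mathrm O}_{2n}(r,t)=\sum_{A\in\mathrm{OSASM}(2n)}r^{R(A)}t^{T(A)}$. *)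

(* Defs.v *)
From mathcomp Require Import all_boot all_order all_algebra.

Set Implicit Arguments.
Unset Strict Implicit.
Unset Printing Implicit Defensive.

Import GRing.Theory Num.Theory.
Local Open Scope ring_scope.

Definition alternating_sign_seq (s : seq int) : bool :=
  let s' := [seq x <- s | x != 0] in
  sorted (fun x y => Num.sg y == - Num.sg x) s' && (\sum_(x <- s') x == 1).

Definition is_asm m (A : 'M[int]_m) : bool :=
  [&& [forall i, forall j, A i j \in [:: -1; 0; 1]],
      [forall i, alternating_sign_seq [seq A i j | j <- enum 'I_m]]
    & [forall j, alternating_sign_seq [seq A i j | i <- enum 'I_m]]].

Definition is_dsasm m (A : 'M[int]_m) : bool := is_asm A && (A^T == A).

Definition is_osasm m (A : 'M[int]_m) : bool :=
  is_dsasm A && [forall i, A i i == 0].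

(* int is not a finType, so the finite set of OSASMs is carved out of the
   matrices over the three-element subtype {-1, 0, 1} of int. *)
Definition asm_entry : finType := seq_sub [:: -1; 0; 1 : int].

Definition int_mx m (A : 'M[asm_entry]_m) : 'M[int]_m :=
  map_mx (fun x : asm_entry => ssval x) A.

Definition OSASM n : {set 'M[asm_entry]_(2 * n)} :=
  [set A | is_osasm (int_mx A)].

Definition R_stat m (A : 'M[int]_m) : nat :=
  (\sum_(i < m) \sum_(j < m | i < j) `|A i j|)%N.

(* Columns are counted from 1, ordinals from 0.  The value 0 is a junk value,
   returned only if the first row has no entry equal to 1. *)
Definition T_stat m (A : 'M[int]_m) : nat :=
  if [pick j | [exists i : 'I_m, (i == 0%N :> nat) && (A i j == 1)]] is Some j
  then j.+1 else 0%N.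

Definition X_O (K : comNzRingType) n (r t : K) : K :=
  \sum_(A in OSASM n) r ^+ R_stat (int_mx A) * t ^+ T_stat (int_mx A).

(* The Laurent polynomial ring Z[r, 1/r, t, 1/t] is the subring of the fraction
   field of Z[r][t] generated by the two indeterminates and their inverses, so
   identities between Laurent polynomials are identities in that field. *)
Definition Frac_rt : fieldType := {fraction {poly {poly int}}}.

Definition indet_r : Frac_rt := tofrac ('X%:P : {poly {poly int}}).
Definition indet_t : Frac_rt := tofrac ('X : {poly {poly int}}).

(* Main.v *)
Require Import Defs.
From mathcomp Require Import all_boot all_order all_algebra all_field.
From mathcomp Require Import ring zify.

(** Let Z be the six-vertex partition function of the upper triangle, where line
  i carries a spectral parameter x_i and the vertex (i, j) has, with u = x_i x_j,
  weight a = A u - B or b = A - B u for an entry 0, g for an entry 1 and d u for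
  an entry -1, under the relation A B g d = (A^2 - B^2)^2.  The Yang-Baxter and
  reflection equations make Z symmetric in the x_i.  As a polynomial in x_1, Z
  has degree less than the number of other lines, so it is determined by its
  values at the points where a(x_1 x_j) = 0.  There lines 1 and j freeze if j is
  the second line, and Z reduces to the partition function of the other lines.
  Exchanging a and b amounts to replacing (A, B) by (-B, -A); at the same points
  the exchanged partition function freezes if j is the last line, with the same
  factor.  By induction, Z is invariant under the exchange for an even number of
  lines.  At (z, 1, ..., 1) the first row contributes a^(T-2) b^(2n-T) and all
  other weights depend only on R, so that exchanging a and b exchanges T with
  2n + 2 - T. *)

Set Implicit Arguments.
Unset Strict Implicit.
Unset Printing Implicit Defensive.

Import Order.TTheory GRing.Theory Num.Theory.

Local Open Scope ring_scope.

(** * Partition function, Yang-Baxter and reflection equations *)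

Section PartitionFunction.
Variables (R : comNzRingType) (A B g d : R).

Definition wgt_a (u : R) := A * u - B.
Definition wgt_b (u : R) := A - B * u.
Definition wgt_c (h : bool) (u : R) := if h then d * u else g.

(** [h] and [v] are the partial sums of the entries strictly left of, and strictly
  above, the vertex; [f] receives the partial sums that include its entry. *)
Definition cell (u : R) (f : bool -> bool -> R) (h v : bool) : R :=
  if h == v then wgt_a u * f h v + wgt_c h u * f (~~ h) (~~ v)
  else wgt_b u * f h v.

(** The row of the line [x], crossing the lines [ys], whose column partial sums
  above the row are [vs]; [h] is the row partial sum on entering, and the
  continuation [k] receives the column partial sums below the row. *)
Fixpoint row (x : R) (h : bool) (ys : seq R) (vs : seq bool)
    (k : seq bool -> R) : R :=
  match ys, vs with
  | y :: ys', v :: vs' =>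
    cell (x * y) (fun h' v' => row x h' ys' vs' (fun ws => k (v' :: ws))) h v
  | [::], [::] => if h then k [::] else 0
  | _, _ => 0
  end.

(** By symmetry of the matrix and since its diagonal vanishes, the row of [x] starts
  right of the diagonal with the column partial sum [v] reached above it. *)
Fixpoint pf (xs : seq R) (vs : seq bool) : R :=
  match xs, vs with
  | x :: xs', v :: vs' => row x v xs' vs' (pf xs')
  | [::], [::] => 1
  | _, _ => 0
  end.

Lemma eq_cell u f1 f2 h v :
  (forall h' v', f1 h' v' = f2 h' v') -> cell u f1 h v = cell u f2 h v.
Proof. by move=> eqf; rewrite /cell !eqf. Qed.

Lemma eq_row x h ys vs k1 k2 :
  (forall ws, size ws = size vs -> k1 ws = k2 ws) ->
  row x h ys vs k1 = row x h ys vs k2.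
Proof.
elim: ys vs h k1 k2 => [|y ys IH] [|v vs] h k1 k2 //= eqk; first by rewrite eqk.
by apply: eq_cell => h' v'; apply: IH => ws sz; rewrite eqk //= sz.
Qed.

Lemma row_lin x h ys vs a1 a2 k1 k2 :
  row x h ys vs (fun ws => a1 * k1 ws + a2 * k2 ws)
  = a1 * row x h ys vs k1 + a2 * row x h ys vs k2.
Proof.
elim: ys vs h k1 k2 => [|y ys IH] [|v vs] h k1 k2 //=;
  try by rewrite !mulr0 addr0.
  by case: h => //; rewrite !mulr0 addr0.
rewrite /cell; case: eqP => _; rewrite !IH; ring.
Qed.

Lemma row_scale x h ys vs a k :
  row x h ys vs (fun ws => a * k ws) = a * row x h ys vs k.
Proof.
rewrite -[RHS]addr0 -(mul0r (row x h ys vs k)) -row_lin.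
by apply: eq_row => ws _; rewrite mul0r addr0.
Qed.

(** Linearity in the continuation lets a vertex on other lines be pulled through a row. *)
Lemma row_cell x h ys vs u (k : bool -> bool -> seq bool -> R) h' v' :
  row x h ys vs (fun ws => cell u (fun a b => k a b ws) h' v')
  = cell u (fun a b => row x h ys vs (k a b)) h' v'.
Proof. by rewrite /cell; case: eqP => _; rewrite ?row_lin ?row_scale. Qed.

Definition rmx_diag (x y : R) := A ^+ 2 * y - B ^+ 2 * x.

(** The R-matrix of two lines [x] and [y], acting on their states. The factor [y] or [x] on the
    state-keeping term matches the gauge in which an entry 1 weighs [g] and an entry -1 weighs
    [d * u]. *)
Definition rmx (x y : R) (f : bool -> bool -> R) (h v : bool) : R :=
  if h == v then rmx_diag x y * f h v
  else (A ^+ 2 - B ^+ 2) * (if h then y else x) * f h v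
       + A * B * (x - y) * f v h.

Lemma eq_rmx x y f1 f2 h v :
  (forall h' v', f1 h' v' = f2 h' v') -> rmx x y f1 h v = rmx x y f2 h v.
Proof. by move=> eqf; rewrite /rmx !eqf. Qed.

Lemma row_rmx z h ys vs x y (k : bool -> bool -> seq bool -> R) a b :
  row z h ys vs (fun ws => rmx x y (fun a b => k a b ws) a b)
  = rmx x y (fun a b => row z h ys vs (k a b)) a b.
Proof. by rewrite /rmx; case: eqP => _; rewrite ?row_lin ?row_scale. Qed.

Lemma cell_scale u f a h v :
  cell u (fun h v => a * f h v) h v = a * cell u f h v.
Proof. by rewrite /cell; case: eqP => _; ring. Qed.

Hypothesis rel : A * B * (g * d) = (A ^+ 2 - B ^+ 2) ^+ 2.

(** The Yang-Baxter equation for two columns crossed by a row. *)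
Lemma ybe_col x y z f h a b :
  rmx x y (fun a b => cell (z * x) (fun h1 a' =>
     cell (z * y) (fun h2 b' => f h2 a' b') h1 b) h a) a b
  = cell (z * y) (fun h1 a' => cell (z * x) (fun h2 b' =>
     rmx x y (f h2) a' b') h1 b) h a.
Proof.
(* The four cases that [ring] leaves open hold only modulo [rel]; [e] is the cofactor of the
   relation. *)
have relE e p q :
    p - q = e * (A * B * (g * d) - (A ^+ 2 - B ^+ 2) ^+ 2) -> p = q.
  by rewrite rel subrr mulr0 => /subr0_eq.
rewrite /rmx /cell /wgt_c /wgt_a /wgt_b /rmx_diag.
case: h; case: a; case: b => /=; try ring.
- by apply: (relE (- (z * y * (x - y) * f true true false))); ring.
- by apply: (relE (z * x * (x - y) * f true false true)); ring.
- by apply: (relE (z * y * (x - y) * f false true false)); ring.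
- by apply: (relE (- (z * x * (x - y) * f false false true))); ring.
Qed.

(** Vertices are invariant under reflection in the diagonal, which interchanges rows and columns in
    the Yang-Baxter equation. *)
Lemma cellC u f h v : cell u f h v = cell u (fun a b => f b a) v h.
Proof. by rewrite /cell eq_sym; case: eqP => [->|]. Qed.

(** The Yang-Baxter equation for two rows crossed by a column. *)
Lemma ybe_row x y z f h1 h2 v :
  rmx x y (fun h1 h2 => cell (x * z) (fun h1' v1 => cell (y * z)
     (fun h2' v2 => f h1' h2' v2) h2 v1) h1 v) h1 h2
  = cell (y * z) (fun h1' v1 => cell (x * z)
     (fun h2' v2 => rmx x y (fun a b => f a b v2) h1' h2') h2 v1) h1 v.
Proof.
rewrite ![_ * z]mulrC cellC.
have := ybe_col x y z (fun c a b => f a b c) v h1 h2; congr (_ = _).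
  apply: eq_rmx => a b; rewrite cellC; apply: eq_cell => a' b'; exact: cellC.
by apply: eq_cell => a' b'; rewrite cellC.
Qed.

(** The reflection equation, at the corner where two columns turn into rows. *)
Lemma refl_eq x y u f h v :
  rmx x y (cell u f) h v = cell u (rmx x y f) h v.
Proof. rewrite /rmx /cell; case: h; case: v => /=; ring. Qed.

(** The R-matrix passes the vertices of [pre], which it does not touch, then the two columns by
    [ybe_col], then [post] by linearity. The assumption on [k] and [k'] is the exchange in the rows
    below. *)
Lemma row_exchange pre post z x y h vs1 vs2 k k' a b :
  size vs1 = size pre ->
  (forall a b ws1 ws2, size ws1 = size pre ->
     rmx x y (fun a b => k (ws1 ++ a :: b :: ws2)) a b
     = rmx_diag x y * k' (ws1 ++ a :: b :: ws2)) ->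
  rmx x y (fun a b => row z h (pre ++ x :: y :: post) (vs1 ++ a :: b :: vs2) k)
    a b
  = rmx_diag x y * row z h (pre ++ y :: x :: post) (vs1 ++ a :: b :: vs2) k'.
Proof.
elim: pre vs1 h k k' => [|w pre IH] [|v vs1] h k k' //=.
  move=> _ kk'; rewrite (ybe_col _ _ _ (fun h' a' b' =>
    row z h' post vs2 (fun ws => k (a' :: b' :: ws)))).
  rewrite -cell_scale; apply: eq_cell => h1 a'.
  rewrite -cell_scale; apply: eq_cell => h2 b'.
  rewrite -row_rmx -row_scale; apply: eq_row => ws _.
  exact: (kk' _ _ [::]).
move=> [sz] kk'.
transitivity (cell (z * w) (fun h' v' => rmx x y (fun a b =>
   row z h' (pre ++ x :: y :: post) (vs1 ++ a :: b :: vs2)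
     (fun ws => k (v' :: ws))) a b) h v).
  by rewrite /rmx /cell; case: eqP => _; case: eqP => _; ring.
rewrite -cell_scale; apply: eq_cell => h' v'; apply: IH => // a' b' ws1 ws2 sw.
by rewrite -(kk' _ _ (v' :: ws1)) //= sw.
Qed.

(** The R-matrix is pushed from the left end of the two rows to the right end, where both row sums
    must be 1 and it acts as the scalar [rmx_diag]. *)
Lemma row2_exchange x y h1 h2 post vs k :
  rmx x y (fun h1 h2 => row x h1 post vs (fun ws => row y h2 post ws k)) h1 h2
  = rmx_diag x y * row y h1 post vs (fun ws => row x h2 post ws k).
Proof.
elim: post vs k h1 h2 => [|z post IH] [|v vs] k h1 h2 /=.
- by rewrite /rmx; case: h1; case: h2 => /=; rewrite ?mulr0 ?addr0.
- by rewrite /rmx; case: ifP; rewrite ?mulr0 ?addr0.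
- by rewrite /rmx; case: ifP; rewrite ?mulr0 ?addr0.
transitivity (rmx x y (fun h1 h2 => cell (x * z) (fun h1' v1 => cell (y * z)
     (fun h2' v2 => row x h1' post vs (fun ws => row y h2' post ws
        (fun ws' => k (v2 :: ws')))) h2 v1) h1 v) h1 h2).
  apply: eq_rmx => a b; apply: eq_cell => a' v1; exact: row_cell.
rewrite (ybe_row _ _ _ (fun h1' h2' v2 => row x h1' post vs (fun ws =>
  row y h2' post ws (fun ws' => k (v2 :: ws'))))).
rewrite -cell_scale; apply: eq_cell => h1' v1.
rewrite row_cell -cell_scale; apply: eq_cell => h2' v2.
exact: IH.
Qed.

(** The R-matrix travels down the two columns by [row_exchange], turns at the corner by [refl_eq]
    and leaves along the two rows by [row2_exchange]. *)
Lemma pf_exchange pre post x y vs1 vs2 a b :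
  size vs1 = size pre ->
  rmx x y (fun a b => pf (pre ++ x :: y :: post) (vs1 ++ a :: b :: vs2)) a b
  = rmx_diag x y * pf (pre ++ y :: x :: post) (vs1 ++ a :: b :: vs2).
Proof.
elim: pre vs1 a b vs2 => [|z pre IH] [|v vs1] a b vs2 //=.
  move=> _; rewrite (refl_eq _ _ _ (fun h v => row x h post vs2
    (fun ws => row y v post ws (pf post)))).
  rewrite [y * x]mulrC -cell_scale; apply: eq_cell => h v.
  exact: row2_exchange.
move=> [sz]; apply: row_exchange => // a' b' ws1 ws2 sw.
exact: IH.
Qed.

Definition pf0 xs := pf xs (nseq (size xs) false).

(** Both lines start in the state [false], on which the R-matrix is the scalar [rmx_diag]. *)
Lemma pf0_swap pre post x y :
  rmx_diag x y * pf0 (pre ++ x :: y :: post)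
  = rmx_diag x y * pf0 (pre ++ y :: x :: post).
Proof.
rewrite /pf0 !size_cat /= !nseqD /= -pf_exchange ?size_nseq //.
Qed.
End PartitionFunction.

(** * Frozen lines and the degree in the first parameter *)

Section Specializations.
Variables (R : comNzRingType) (A B g d : R).
Local Notation wa := (wgt_a A B).
Local Notation wb := (wgt_b A B).
Local Notation row := (row A B g d).
Local Notation pf := (pf A B g d).
Local Notation pf0 := (pf0 A B g d).

(** An entry -1 requires both partial sums to be 1, so only zeros of weight [b] can follow. *)
Lemma row_true_false x ys k :
  row x true ys (nseq (size ys) false) k
  = \prod_(y <- ys) wb (x * y) * k (nseq (size ys) false).
Proof.
elim: ys k => [|y ys IH] k /=; first by rewrite big_nil mul1r.
by rewrite /cell /= IH big_cons mulrA.
Qed.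

(** As 0 has weight [a], now vanishing, where the two lines meet, the entry there is 1 and both rows
    continue with zeros. *)
Lemma pf0_front x y xs : wa (x * y) = 0 ->
  pf0 [:: x, y & xs]
  = g * \prod_(z <- xs) (wb (x * z) * wb (y * z)) * pf0 xs.
Proof.
move=> wa0; rewrite /pf0 /= /cell /= wa0 mul0r add0r !row_true_false.
by rewrite big_split /= !mulrA.
Qed.

(** A 1 before the last column would leave there a 0 of the vanishing weight [b]; hence the 1 is in
    the last column. *)
Lemma row_false_last x y ys k : wb (x * y) = 0 ->
  row x false (rcons ys y) (nseq (size ys).+1 false) k
  = \prod_(z <- ys) wa (x * z) * g * k (rcons (nseq (size ys) false) true).
Proof.
move=> wb0; elim: ys k => [|z ys IH] k /=.
  by rewrite /cell /= big_nil mulr0 add0r mul1r.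
rewrite /cell [false == false]/= [~~ false]/=.
have := row_true_false x (rcons ys y) (fun ws => k (true :: ws)).
rewrite size_rcons => ->.
by rewrite IH big_rcons /= wb0 mulr0 !mul0r mulr0 addr0 big_cons !mulrA.
Qed.

(** The row must end with sum 1, while the last column, of sum 1, admits only 0 or -1: the entry is
    0 of weight [a]. *)
Lemma row_rcons_true x h y ys vs k : size vs = size ys ->
  row x h (rcons ys y) (rcons vs true) k
  = wa (x * y) * row x h ys vs (fun ws => k (rcons ws true)).
Proof.
elim: ys vs h k => [|z ys IH] [|v vs] //= h k.
  by move=> _; rewrite /cell; case: h; rewrite ?mulr0 ?addr0.
move=> [sz]; rewrite -cell_scale; apply: eq_cell => h' v'; exact: IH.
Qed.

Lemma pf_rcons_true xs y vs : size vs = size xs ->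
  pf (rcons xs y) (rcons vs true) = \prod_(x <- xs) wa (x * y) * pf xs vs.
Proof.
elim: xs vs => [|x xs IH] [|v vs] //=; first by rewrite big_nil mul1r.
move=> [sz]; rewrite row_rcons_true // big_cons -mulrA; congr (_ * _).
by rewrite -row_scale; apply: eq_row => ws sw; rewrite IH ?sw.
Qed.

Lemma pf0_last x xs y : wb (x * y) = 0 ->
  pf0 (x :: rcons xs y)
  = g * \prod_(z <- xs) (wa (x * z) * wa (z * y)) * pf0 xs.
Proof.
move=> wb0; rewrite /pf0 /= size_rcons row_false_last // pf_rcons_true ?size_nseq //.
by rewrite big_split /=; ring.
Qed.

Lemma row_true_poly ys k :
  exists2 p : {poly R}, (size p <= (size ys).+1)%N &
    forall x, row x true ys (nseq (size ys) false) k = p.[x].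
Proof.
elim: ys k => [|y ys IH] k /=.
  by exists (k [::])%:P => [|x]; rewrite ?hornerC ?size_polyC_leq1.
have [p szp pE] := IH (fun ws => k (false :: ws)).
exists ((A%:P - (B * y) *: 'X) * p) => [|x].
  apply: (leq_trans (size_polyMleq _ _)); rewrite -subn1 leq_subLR.
  rewrite -[(size ys).+2]/(1 + (size ys).+1)%N addnA leq_add //.
  rewrite (leq_trans (size_polyD _ _)) // geq_max size_polyN.
  rewrite (leq_trans (size_polyC_leq1 _)) //.
  by rewrite (leq_trans (size_scale_leq _ _)) // size_polyX.
by rewrite /cell /= pE !hornerE /wgt_b /=; ring.
Qed.

(** The entry that raises the row sum to 1 has the constant weight [g], which lowers the degree
    below the number of crossings. *)
Lemma row_false_poly ys k :
  exists2 p : {poly R}, (size p <= size ys)%N &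
    forall x, row x false ys (nseq (size ys) false) k = p.[x].
Proof.
elim: ys k => [|y ys IH] k /=.
  by exists 0 => [|x]; rewrite ?horner0 ?size_poly0.
have [p szp pE] := IH (fun ws => k (false :: ws)).
have [p' szp' pE'] := row_true_poly ys (fun ws => k (true :: ws)).
exists (((A * y) *: 'X - B%:P) * p + g *: p') => [|x].
  rewrite (leq_trans (size_polyD _ _)) // geq_max.
  rewrite (leq_trans (size_scale_leq _ _)) // andbT.
  apply: (leq_trans (size_polyMleq _ _)); rewrite -subn1 leq_subLR.
  rewrite -[(size ys).+1]/(1 + (size ys))%N addnA leq_add //.
  rewrite (leq_trans (size_polyD _ _)) // geq_max size_polyN.
  rewrite (leq_trans (size_polyC_leq1 _)) // andbT.
  by rewrite (leq_trans (size_scale_leq _ _)) // size_polyX.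
by rewrite /cell /= pE pE' !hornerE /wgt_a /=; ring.
Qed.

Lemma pf0_poly xs :
  exists2 p : {poly R}, (size p <= size xs)%N & forall x, pf0 (x :: xs) = p.[x].
Proof. exact: row_false_poly. Qed.

End Specializations.

(** * Invariance under the exchange of [a] and [b] *)

Lemma pf0_move (D : idomainType) (A B g d : D) p0 pre y post :
  A * B * (g * d) = (A ^+ 2 - B ^+ 2) ^+ 2 ->
  {in pre, forall z, rmx_diag A B z y != 0} ->
  pf0 A B g d (p0 ++ pre ++ y :: post) = pf0 A B g d (p0 ++ y :: pre ++ post).
Proof.
move=> rel; elim/last_ind: pre post => [//|pre z IH] post nz.
have /mulfI inj : rmx_diag A B z y != 0.
  by apply: nz; rewrite mem_rcons mem_head.
rewrite !cat_rcons catA (inj _ _ (pf0_swap rel _ _ _ _)) -catA IH // => t tpre.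
by apply: nz; rewrite mem_rcons inE tpre orbT.
Qed.

(** The first two conditions make the interpolation nodes [B / (A * y)] well defined and distinct;
    the third keeps [rmx_diag] nonzero, so that lines can be reordered. *)
Definition generic (D : idomainType) (A B : D) (xs : seq D) :=
  [/\ uniq xs, {in xs, forall x, x != 0} &
      {in xs &, forall x y, x != y -> A ^+ 2 * y != B ^+ 2 * x}].

Lemma pf0_dual (K : fieldType) (A B g d : K) x xs :
  A * B * (g * d) = (A ^+ 2 - B ^+ 2) ^+ 2 -> A != 0 -> B != 0 ->
  odd (size xs) -> generic A B xs ->
  pf0 A B g d (x :: xs) = pf0 (- B) (- A) g d (x :: xs).
Proof.
move=> rel A0 B0.
have rel' : - B * - A * (g * d) = ((- B) ^+ 2 - (- A) ^+ 2) ^+ 2.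
  by rewrite mulrNN [B * A]mulrC rel; ring.
have [n] := ubnP (size xs); elim: n x xs => // n IH x xs lt_n odd_xs gen.
have [uxs xs0 xsAB] := gen.
have [p szp pE] := pf0_poly A B g d xs.
have [q szq qE] := pf0_poly (- B) (- A) g d xs.
suff pq : p - q = 0 by rewrite pE qE (subr0_eq pq).
apply/eqP/negPn/negP => pq0.
have := max_poly_roots (rs := [seq B / (A * y) | y <- xs]) pq0.
suff [-> ->]: all (root (p - q)) [seq B / (A * y) | y <- xs] /\
              uniq [seq B / (A * y) | y <- xs].
  move/(_ isT isT); rewrite size_map ltnNge => /negP; apply.
  by rewrite (leq_trans (size_polyD _ _)) // geq_max size_polyN szp.
split; last first.
  rewrite map_inj_in_uniq // => y z _ _ /=.
  by move/(mulfI B0)/invr_inj/(mulfI A0).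
apply/allP => _ /mapP[y yxs ->].
rewrite rootE !hornerE subr_eq0 -pE -qE; apply/eqP.
have y0 := xs0 y yxs; set z := B / _.
have zy : A * (z * y) = B by rewrite /z; field; rewrite y0.
(* The same node freezes both partition functions, with [y] second in one and last in the other. *)
have waE : wgt_a A B (z * y) = 0 by rewrite /wgt_a zy subrr.
have wbE : wgt_b (- B) (- A) (z * y) = 0.
  by rewrite /wgt_b mulNr zy opprK addNr.
have [pre [post xsE]] : exists pre post, xs = pre ++ y :: post.
  by case/splitPr: yxs => pre post; exists pre, post.
have nAB t : t \in pre ++ post ->
    rmx_diag A B t y != 0 /\ rmx_diag (- B) (- A) t y != 0.
  move=> tpp; have txs : t \in xs.
    by move: tpp; rewrite xsE !mem_cat inE => /orP[]->; rewrite ?orbT.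
  have ty : t != y.
    apply: contraL tpp => /eqP ->.
    move: uxs; rewrite xsE -cat1s uniq_catCA cat1s /=; by case/andP.
  rewrite /rmx_diag !subr_eq0 xsAB // !sqrrN; split=> //.
  by rewrite eq_sym xsAB // eq_sym.
have -> : pf0 A B g d (z :: xs) = pf0 A B g d [:: z, y & pre ++ post].
  rewrite xsE; apply: (pf0_move [:: z]) => // t tpre.
  by have [] := nAB t; rewrite // mem_cat tpre.
have -> : pf0 (- B) (- A) g d (z :: xs)
        = pf0 (- B) (- A) g d (z :: rcons (pre ++ post) y).
  have mv pre' post' : {subset pre' <= pre ++ post} ->
      pf0 (- B) (- A) g d (z :: pre' ++ y :: post')
      = pf0 (- B) (- A) g d (z :: y :: pre' ++ post').
    move=> sub; apply: (pf0_move [:: z]) => // t /sub tpp.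
    by have [] := nAB t tpp.
  rewrite -cats1 xsE !mv ?cats0 // => t tpre; by rewrite mem_cat tpre.
rewrite pf0_front // pf0_last //; congr (_ * _ * _).
  apply: eq_bigr => t _; rewrite /wgt_a /wgt_b [t * y]mulrC.
  by congr (_ * _); ring.
have : ~~ odd (size (pre ++ post)).
  by move: odd_xs; rewrite xsE !size_cat /= addnS.
have : ((size (pre ++ post)).+1 < n.+1)%N.
  by move: lt_n; rewrite xsE !size_cat /= addnS.
have : {subset pre ++ post <= xs} /\ uniq (pre ++ post).
  split; first by move=> t; rewrite xsE !mem_cat inE => /orP[]->; rewrite ?orbT.
  by move: uxs; rewrite xsE -cat1s uniq_catCA cat1s /=; case/andP.
(* An even number of lines remains: either none, or a first line and an odd number of others. *)
case: (pre ++ post) => [//|x' xs'] [sub uxs'] lt' odd'.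
apply: IH; [exact: ltnW | by move: odd' => /=; rewrite negbK |].
have sub' t : t \in xs' -> t \in xs.
  by move=> txs; apply: sub; rewrite inE txs orbT.
split; first by case/andP: uxs'.
  by move=> t /sub'/xs0.
by move=> t u /sub' ? /sub' ?; apply: xsAB.
Qed.

Lemma row_rmorph (R S : comNzRingType) (f : {rmorphism R -> S}) A B g d
    x h ys vs k k' :
  (forall ws, f (k ws) = k' ws) ->
  f (row A B g d x h ys vs k)
  = row (f A) (f B) (f g) (f d) (f x) h (map f ys) vs k'.
Proof.
elim: ys vs h k k' => [|y ys IH] [|v vs] h k k' kk' //=; rewrite ?rmorph0 //.
  by case: h; rewrite ?rmorph0.
rewrite /cell /wgt_a /wgt_b /wgt_c; case: eqP => _; last first.
  rewrite !rmorphM rmorphB !rmorphM.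
  by rewrite (IH _ _ _ (fun ws => k' (v :: ws))).
rewrite rmorphD !rmorphM rmorphB !rmorphM.
rewrite (IH _ _ _ (fun ws => k' (v :: ws))) //.
rewrite (IH _ _ _ (fun ws => k' (~~ v :: ws))) //.
by case: h; rewrite ?rmorphM.
Qed.

Lemma pf_rmorph (R S : comNzRingType) (f : {rmorphism R -> S}) A B g d xs vs :
  f (pf A B g d xs vs) = pf (f A) (f B) (f g) (f d) (map f xs) vs.
Proof.
elim: xs vs => [|x xs IH] [|v vs] //=; rewrite ?rmorph0 ?rmorph1 //.
exact: row_rmorph.
Qed.

Lemma pf0_rmorph (R S : comNzRingType) (f : {rmorphism R -> S}) A B g d xs :
  f (pf0 A B g d xs) = pf0 (f A) (f B) (f g) (f d) (map f xs).
Proof. by rewrite /pf0 pf_rmorph size_map. Qed.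

(** Distinct powers have distinct degrees, which nonzero constant factors do not change. *)
Lemma generic_powers (K : fieldType) (A B : K) m : A != 0 -> B != 0 ->
  generic (tofrac A%:P) (tofrac B%:P)
    [seq tofrac ('X^i : {poly K}) | i <- iota 0 m].
Proof.
move=> A0 B0.
have tofrac_inj : injective (@tofrac {poly K}).
  by move=> p q /eqP; rewrite tofrac_eq => /eqP.
have szXn (c : K) i : c != 0 -> size (c%:P * 'X^i) = i.+1.
  by move=> c0; rewrite mul_polyC size_scale // size_polyXn.
split.
- rewrite map_inj_uniq ?iota_uniq // => i j /tofrac_inj /(congr1 (size \o val)).
  by rewrite /= !size_polyXn => -[].
- by move=> _ /mapP[i _ ->]; rewrite tofrac_eq0 -size_poly_eq0 size_polyXn.
move=> _ _ /mapP[i _ ->] /mapP[j _ ->] ij.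
rewrite -!tofracXn -!tofracM tofrac_eq -!polyC_exp.
apply: contraNneq ij => /(congr1 (fun p : {poly K} => size p)).
by rewrite !szXn ?expf_neq0 // => -[->].
Qed.

(** The parameters 1, ..., 1 are not generic; they are reached by evaluating the
  formal powers of ['X] at 1. *)
Lemma pf0_dual_ones (K : fieldType) (A B g d z : K) m :
  A * B * (g * d) = (A ^+ 2 - B ^+ 2) ^+ 2 -> A != 0 -> B != 0 -> odd m ->
  pf0 A B g d (z :: nseq m 1) = pf0 (- B) (- A) g d (z :: nseq m 1).
Proof.
move=> rel A0 B0 odd_m.
pose xs : seq {poly K} := z%:P :: [seq 'X^i | i <- iota 0 m].
have evE (a b : K) : pf0 a b g d (z :: nseq m 1)
    = (pf0 a%:P b%:P g%:P d%:P xs).[1].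
  rewrite -[RHS]/(horner_eval 1 _) pf0_rmorph /= /horner_eval !hornerC.
  congr pf0; congr (_ :: _).
  elim: m {xs odd_m} 0%N => //= n IH k; rewrite hornerXn expr1n.
  congr (_ :: _); exact: IH.
rewrite !evE; congr _.[1]; apply/eqP; rewrite -tofrac_eq; apply/eqP.
rewrite !pf0_rmorph /= !polyCN !rmorphN /= -map_comp.
apply: pf0_dual; rewrite ?tofrac_eq0 ?polyC_eq0 ?size_map ?size_iota //.
  by rewrite -!tofracM -!polyCM rel -!tofracXn -tofracB -tofracXn
             !polyC_exp polyCB !polyC_exp.
exact: generic_powers.
Qed.

(** * Alternating sign sequences through their partial sums *)

Definition entry_step (h : bool) : int := if h then -1 else 1.

(** Alternation with total 1 means that all partial sums are 0 or 1 and the last is 1; [h] is the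
    current partial sum. *)
Fixpoint asm_row (h : bool) (us : seq int) : bool :=
  if us is u :: us' then
    if u == 0 then asm_row h us'
    else (u == entry_step h) && asm_row (~~ h) us'
  else h.

Fixpoint asm_step (vs : seq bool) (us : seq int) : bool :=
  match vs, us with
  | v :: vs', u :: us' => ((u == 0) || (u == entry_step v)) && asm_step vs' us'
  | _, _ => true
  end.

Definition update (vs : seq bool) (us : seq int) : seq bool :=
  [seq p.1 (+) (p.2 != 0) | p <- zip vs us].

Definition ord_seq T m (f : 'I_m -> T) : seq T := [seq f i | i <- enum 'I_m].

Lemma ord_seqS T m (f : 'I_m.+1 -> T) :
  ord_seq f = f ord0 :: ord_seq (fun i => f (lift ord0 i)).
Proof. by rewrite /ord_seq enum_ordSl /= -map_comp. Qed.

Lemma eq_ord_seq T m (f1 f2 : 'I_m -> T) : f1 =1 f2 -> ord_seq f1 = ord_seq f2.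
Proof. by move=> eqf; apply: eq_map. Qed.

Lemma size_ord_seq T m (f : 'I_m -> T) : size (ord_seq f) = m.
Proof. by rewrite size_map size_enum_ord. Qed.

Lemma nth_ord_seq T m (f : 'I_m -> T) x0 (i : 'I_m) : nth x0 (ord_seq f) i = f i.
Proof. by rewrite (nth_map i) ?size_enum_ord // nth_ord_enum. Qed.

Lemma alternating_sign_seqE us : {in us, forall u, u \in [:: -1; 0; 1 : int]} ->
  alternating_sign_seq us = asm_row false us.
Proof.
move=> us_in; rewrite /alternating_sign_seq.
pose nzs := [seq x <- us | x != 0].
have nzs_in : {in nzs, forall u, u = 1 \/ u = -1}.
  move=> u; rewrite mem_filter => /andP[u0 /us_in]; rewrite !inE.
  by move: u0 => /negPf ->; case/or3P => // /eqP ->; auto.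
pose alt (x y : int) := Num.sg y == - Num.sg x.
(* The partial sum [h] is encoded by a fictitious preceding nonzero entry, equal to
   [- entry_step h]. *)
have asm_rowE h : asm_row h us = path alt (- entry_step h) nzs
                                 && (\sum_(x <- nzs) x == (~~ h)%:R).
  rewrite {nzs_in}/nzs; elim: us us_in h => [|u us IH] us_in h /=.
    by rewrite big_nil; case: h.
  have {}IH := IH (fun x xus => us_in x (mem_behead (s := u :: us) xus)).
  have := us_in u (mem_head _ _); rewrite !inE => /or3P[]/eqP-> /=.
  - case: h => /=; rewrite ?andbF // IH /= big_cons; congr (_ && _).
    by rewrite addrC subr_eq0.
  - by rewrite IH.
  - case: h => /=; rewrite ?andbF // IH /= big_cons; congr (_ && _).
    by rewrite -[X in _ = (_ == X)]addr0 (inj_eq (addrI _)).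
rewrite asm_rowE /= -/nzs -/alt.
(* An alternating sum is 0 or its first term, so total 1 excludes a first entry -1. *)
have sum_alt u vs : u = 1 \/ u = -1 -> {in vs, forall u : int, u = 1 \/ u = -1} ->
    path alt u vs -> u + \sum_(x <- vs) x = 0 \/ u + \sum_(x <- vs) x = u.
  elim: vs u => [|v vs IH] u; first by rewrite big_nil addr0; right.
  move=> u1 vs1 /= /andP[uv pv]; rewrite big_cons.
  have vu : v = - u.
    by move: uv; have [->|->] := vs1 v (mem_head _ _); case: u1 => ->;
      rewrite /alt ?sgrN1 ?sgr1 ?opprK.
  have vs1' x : x \in vs -> x = 1 \/ x = -1.
    by move=> xvs; apply: vs1; rewrite inE xvs orbT.
  have := IH v (vs1 v (mem_head _ _)) vs1' pv.
  by case=> vsE; [right; rewrite vsE addr0|left; rewrite vsE vu addrN].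
clear asm_rowE; case: nzs nzs_in => [|u vs] //= nzs_in; rewrite [alt _ _]/alt /=.
have vs1 x : x \in vs -> x = 1 \/ x = -1.
  by move=> xvs; apply: nzs_in; rewrite inE xvs orbT.
have [->//|->] := nzs_in u (mem_head _ _).
apply/negbTE/negP => /andP[/(sum_alt _ _ (or_intror erefl) vs1)].
by rewrite big_cons => -[] ->.
Qed.

Definition entry_m1 : asm_entry := SeqSub (isT : -1 \in [:: -1; 0; 1 : int]).
Definition entry_0 : asm_entry := SeqSub (isT : 0 \in [:: -1; 0; 1 : int]).
Definition entry_1 : asm_entry := SeqSub (isT : 1 \in [:: -1; 0; 1 : int]).

Lemma asm_entry_in (e : asm_entry) : ssval e \in [:: -1; 0; 1 : int].
Proof. exact: ssvalP. Qed.

Lemma sum_asm_entry (V : nmodType) (F : asm_entry -> V) :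
  \sum_e F e = F entry_m1 + (F entry_0 + F entry_1).
Proof.
rewrite (bigD1 entry_m1) // (bigD1 entry_0) // (bigD1 entry_1) //=.
rewrite [X in _ + (_ + (_ + X))]big_pred0 ?addr0 // => e.
apply/negP; rewrite -!val_eqE /= => /andP[/andP[e1 e2] e3].
by have := asm_entry_in e; rewrite !inE (negPf e1) (negPf e2) (negPf e3).
Qed.

Definition ffun_cons T m (e : T) (u : {ffun 'I_m -> T}) : {ffun 'I_m.+1 -> T} :=
  [ffun j => oapp u e (unlift ord0 j)].

Lemma sum_ffun_cons (V : nmodType) (T : finType) m
    (F : {ffun 'I_m.+1 -> T} -> V) :
  \sum_u F u = \sum_e \sum_u F (ffun_cons e u).
Proof.
rewrite pair_bigA (reindex (fun p => ffun_cons p.1 p.2)) //=.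
exists (fun u : {ffun _} => (u ord0, [ffun j => u (lift ord0 j)])).
  move=> [e u] _; rewrite /ffun_cons !ffunE unlift_none; congr (_, _).
  by apply/ffunP => j; rewrite !ffunE liftK.
move=> u _; apply/ffunP => j; rewrite !ffunE.
by case: unliftP => [i ->|->] /=; rewrite ?ffunE.
Qed.

Definition entry_seq m (u : 'I_m -> asm_entry) : seq int :=
  ord_seq (fun j => ssval (u j)).

Lemma entry_seq_cons m e (u : {ffun 'I_m -> asm_entry}) :
  entry_seq (ffun_cons e u) = ssval e :: entry_seq u.
Proof.
rewrite /entry_seq ord_seqS ffunE unlift_none; congr (_ :: _).
by apply: eq_ord_seq => j; rewrite ffunE liftK.
Qed.

(** * Row weights as sums over matrix rows *)

Section RowSum.
Variables (R : comNzRingType) (A B g d x : R).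

Fixpoint row_wgt (h : bool) (vs : seq bool) (us : seq int) : R :=
  match vs, us with
  | v :: vs', u :: us' =>
    if u == 0 then (if h == v then wgt_a A B x else wgt_b A B x) * row_wgt h vs' us'
    else if (h == v) && (u == entry_step h) then
      wgt_c g d h x * row_wgt (~~ h) vs' us'
    else 0
  | _, _ => h%:R
  end.

Lemma row_sum m h vs k : size vs = m ->
  row A B g d x h (nseq m 1) vs k
  = \sum_(u : {ffun 'I_m -> asm_entry})
       row_wgt h vs (entry_seq u) * k (update vs (entry_seq u)).
Proof.
elim: m h vs k => [|m IH] h [|v vs] k //=.
  move=> _; rewrite (big_pred1 [ffun=> entry_0]); last first.
    by move=> u; apply/esym/eqP/ffunP => -[].
  rewrite /entry_seq (size0nil (size_ord_seq _)) /update /=.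
  by case: h; rewrite ?mul1r ?mul0r.
move=> [sz]; rewrite mulr1 sum_ffun_cons sum_asm_entry /cell.
under eq_bigr do rewrite entry_seq_cons /update /=.
under [X in _ + (X + _)]eq_bigr do rewrite entry_seq_cons /update /=.
under [X in _ + (_ + X)]eq_bigr do rewrite entry_seq_cons /update /=.
have sum0 (k' : {ffun 'I_m -> asm_entry} -> R) : \sum_u 0 * k' u = 0.
  by rewrite big1 // => u _; rewrite mul0r.
have sumM c (k1 k2 : {ffun 'I_m -> asm_entry} -> R) :
    c * \sum_u k1 u * k2 u = \sum_u c * k1 u * k2 u.
  by rewrite big_distrr /=; apply: eq_bigr => u _; rewrite mulrA.
rewrite !IH // /update !sumM.
case: h; case: v => /=; rewrite ?sum0 ?addr0 ?add0r // addrC //.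
Qed.
End RowSum.

(** At spectral parameter 1, both [a] and [b] equal [A - B = 1], so only nonzero entries are
    weighted. *)
Lemma row_wgt_unif (R : comNzRingType) (A B r : R) h vs us :
  A - B = 1 -> size vs = size us ->
  row_wgt A B r r 1 h vs us
  = if asm_row h us && asm_step vs us then r ^+ count (fun u => u != 0) us else 0.
Proof.
move=> AB1; elim: vs h us => [|v vs IH] h [|u us] //=; first by case: h.
case=> sz; rewrite /wgt_a /wgt_b /wgt_c !mulr1 AB1 if_same.
case: eqP => [->|u0] /=; rewrite !IH //; first by rewrite mul1r.
case: (u =P entry_step h) => [->|_]; last by rewrite andbF.
case: h; case: v => //=; rewrite ?andbF //; case: ifP => _;
  by rewrite ?mulr0 // -exprS.
Qed.

Lemma row_wgt_first (R : comNzRingType) (A B g d x : R) us :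
  row_wgt A B g d x false (nseq (size us) false) us
  = if asm_row false us && asm_step (nseq (size us) false) us then
      wgt_a A B x ^+ index 1 us * g * wgt_b A B x ^+ ((size us).-1 - index 1 us)
    else 0.
Proof.
have trueE vs : row_wgt A B g d x true (nseq (size vs) false) vs =
    if asm_row true vs && asm_step (nseq (size vs) false) vs
    then wgt_b A B x ^+ size vs else 0.
  elim: vs => [|u vs IH] //=.
  case: eqP => [->|u0] /=; first by rewrite IH exprS; case: ifP; rewrite ?mulr0.
  by case: ifP => // /andP[/andP[/eqP -> _]].
elim: us => [|u us IH] //=.
case: eqP => [->|u0] /=.
  rewrite IH; case: ifP; rewrite ?mulr0 // => /andP[].
  case: us {IH} => // u' us _ _.
  by rewrite /= subSS exprS !mulrA.
case: (u =P 1) => [_|_] //=; rewrite subn0 expr0 mul1r trueE.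
by case: ifP; rewrite ?mulr0.
Qed.

(** * Recursive structure of OSASMs *)

(** The lower right corners of OSASMs, for given column partial sums [vs] (which by
  symmetry are also the row partial sums) over the removed lines. *)
Definition partial_osasm m (vs : seq bool) (M : 'M[asm_entry]_m) : bool :=
  [&& M^T == M, [forall i, ssval (M i i) == 0]
    & [forall i : 'I_m, asm_row (nth false vs i) (entry_seq (M i))]].

Lemma is_osasmE m (M : 'M[asm_entry]_m) :
  is_osasm (int_mx M) = partial_osasm (nseq m false) M.
Proof.
rewrite /is_osasm /is_dsasm /is_asm /partial_osasm.
have trE : ((int_mx M)^T == int_mx M) = (M^T == M).
  apply/eqP/eqP => [/matrixP MT|MT]; apply/matrixP => i j.
    by have := MT i j; rewrite !mxE => /val_inj.
  by rewrite !mxE -[in RHS]MT mxE.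
rewrite trE; case: (M^T =P M) => [MT|]; rewrite ?andbF //= andbT.
have -> : [forall i, forall j, int_mx M i j \in [:: -1; 0; 1]].
  by apply/forallP => i; apply/forallP => j; rewrite mxE asm_entry_in.
have rowE i : alternating_sign_seq [seq int_mx M i j | j <- enum 'I_m]
    = asm_row (nth false (nseq m false) i) (entry_seq (M i)).
  rewrite nth_nseq if_same -alternating_sign_seqE; last first.
    by move=> _ /mapP[j _ ->]; apply: asm_entry_in.
  by congr alternating_sign_seq; apply: eq_map => j; rewrite mxE.
have colE : [forall j, alternating_sign_seq [seq int_mx M i j | i <- enum 'I_m]]
    = [forall i, alternating_sign_seq [seq int_mx M i j | j <- enum 'I_m]].
  apply: eq_forallb => j; congr alternating_sign_seq; apply: eq_map => i.
  by rewrite !mxE -[in LHS]MT mxE.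
rewrite colE andbb (eq_forallb rowE) andbC; congr (_ && _).
by apply: eq_forallb => i; rewrite mxE.
Qed.

Definition mx_cons m (u : {ffun 'I_m -> asm_entry}) (M : 'M[asm_entry]_m)
    : 'M[asm_entry]_m.+1 :=
  \matrix_(i, j)
    if unlift ord0 i is Some i' then oapp (M i') (u i') (unlift ord0 j)
    else oapp u entry_0 (unlift ord0 j).

Lemma mx_cons00 m u (M : 'M_m) : mx_cons u M ord0 ord0 = entry_0.
Proof. by rewrite mxE unlift_none. Qed.

Lemma mx_cons0S m u (M : 'M_m) j : mx_cons u M ord0 (lift ord0 j) = u j.
Proof. by rewrite mxE unlift_none liftK. Qed.

Lemma mx_consS0 m u (M : 'M_m) i : mx_cons u M (lift ord0 i) ord0 = u i.
Proof. by rewrite mxE unlift_none liftK. Qed.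

Lemma mx_consSS m u (M : 'M_m) i j :
  mx_cons u M (lift ord0 i) (lift ord0 j) = M i j.
Proof. by rewrite mxE !liftK. Qed.

Lemma forall_ordS m (P : pred 'I_m.+1) :
  [forall i, P i] = P ord0 && [forall i, P (lift ord0 i)].
Proof.
apply/forallP/andP => [allP|[P0 /forallP PS] i].
  by split=> //; apply/forallP => i.
by case: (unliftP ord0 i) => [j|] ->.
Qed.

Lemma forallb_and (I : finType) (P Q : pred I) :
  [forall i, P i && Q i] = [forall i, P i] && [forall i, Q i].
Proof.
apply/forallP/andP => [PQ|[/forallP allP /forallP allQ] i].
  by split; apply/forallP => i; case/andP: (PQ i).
by rewrite allP allQ.
Qed.

Lemma tr_mx_cons m u (M : 'M_m) : ((mx_cons u M)^T == mx_cons u M) = (M^T == M).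
Proof.
apply/eqP/eqP => [|MT].
  move/matrixP => MT; apply/matrixP => i j.
  by have := MT (lift ord0 i) (lift ord0 j); rewrite !mxE !liftK.
apply/matrixP => i j; rewrite !mxE.
by case: unliftP => [i' _|_]; case: unliftP => [j' _|_] //=; rewrite -[in RHS]MT mxE.
Qed.

Lemma asm_stepE vs m (us : 'I_m -> int) : size vs = m ->
  asm_step vs (ord_seq us)
  = [forall i : 'I_m, (us i == 0) || (us i == entry_step (nth false vs i))].
Proof.
elim: m vs us => [|m IH] [|v vs] us //=.
  by move=> _; apply/esym/forallP => -[].
by move=> [sz]; rewrite forall_ordS ord_seqS /= IH.
Qed.

Lemma nth_update vs m (us : 'I_m -> int) (i : 'I_m) : size vs = m ->
  nth false (update vs (ord_seq us)) i = nth false vs i (+) (us i != 0).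
Proof.
move=> sz; have lti : (i < size (zip vs (ord_seq us)))%N.
  by rewrite size_zip size_ord_seq sz minnn.
by rewrite (nth_map (false, 0)) // nth_zip ?size_ord_seq //= nth_ord_seq.
Qed.

(** The first row is also the first column, so each of its entries advances the partial sum of one
    remaining row. *)
Lemma partial_osasm_cons m v vs u (M : 'M_m) : size vs = m ->
  partial_osasm (v :: vs) (mx_cons u M)
  = asm_row v (entry_seq u) && asm_step vs (entry_seq u)
    && partial_osasm (update vs (entry_seq u)) M.
Proof.
move=> sz; rewrite /partial_osasm tr_mx_cons !forall_ordS /= mx_cons00 /=.
have -> : [forall i, ssval (mx_cons u M (lift ord0 i) (lift ord0 i)) == 0]
    = [forall i, ssval (M i i) == 0].
  by apply: eq_forallb => i; rewrite mx_consSS.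
have -> : asm_row v (entry_seq (mx_cons u M ord0)) = asm_row v (entry_seq u).
  rewrite /entry_seq ord_seqS mx_cons00 /=.
  by congr asm_row; apply: eq_ord_seq => j; rewrite mx_cons0S.
have -> : [forall i : 'I_m,
      asm_row (nth false vs i) (entry_seq (mx_cons u M (lift ord0 i)))]
    = [forall i : 'I_m,
        ((ssval (u i) == 0) || (ssval (u i) == entry_step (nth false vs i)))
        && asm_row (nth false (update vs (entry_seq u)) i) (entry_seq (M i))].
  apply: eq_forallb => i.
  rewrite nth_update // {1}/entry_seq ord_seqS mx_consS0 /=.
  rewrite (eq_ord_seq (f2 := fun j => ssval (M i j))); last first.
    by move=> j; rewrite mx_consSS.
  by case: eqP => [_|_] /=; rewrite ?addbF ?addbT.
rewrite forallb_and -asm_stepE // -/(entry_seq u).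
case: (M^T == M); rewrite ?andbF //=; case: [forall i, _]; rewrite ?andbF //=.
by rewrite andbA.
Qed.

Lemma mx_cons_eta m (M : 'M[asm_entry]_m.+1) :
  M^T = M -> ssval (M ord0 ord0) = 0 ->
  mx_cons [ffun j => M ord0 (lift ord0 j)]
    (\matrix_(i, j) M (lift ord0 i) (lift ord0 j)) = M.
Proof.
move=> MT M00; apply/matrixP => i j; rewrite !mxE.
case: unliftP => [i' ->|->]; case: unliftP => [j' ->|->] /=.
- by rewrite mxE.
- by rewrite ffunE -[in LHS]MT mxE.
- by rewrite ffunE.
- exact/val_inj/esym.
Qed.

Lemma sum_partial_osasm (V : nmodType) m v vs (F : 'M[asm_entry]_m.+1 -> V) :
  size vs = m ->
  \sum_(M | partial_osasm (v :: vs) M) F M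
  = \sum_(u : {ffun 'I_m -> asm_entry}
           | asm_row v (entry_seq u) && asm_step vs (entry_seq u))
      \sum_(M | partial_osasm (update vs (entry_seq u)) M) F (mx_cons u M).
Proof.
move=> sz; rewrite pair_big_dep /=.
rewrite (reindex_onto (fun p => mx_cons p.1 p.2) (fun M =>
   ([ffun j => M ord0 (lift ord0 j)], \matrix_(i, j) M (lift ord0 i) (lift ord0 j)))).
  apply: eq_bigl => -[u M] /=; rewrite partial_osasm_cons // -andbA.
  suff -> : ([ffun j => mx_cons u M ord0 (lift ord0 j)],
     \matrix_(i, j) mx_cons u M (lift ord0 i) (lift ord0 j)) = (u, M).
    by rewrite eqxx andbT andbA.
  congr (_, _); first by apply/ffunP => j; rewrite ffunE mx_cons0S.
  by apply/matrixP => i j; rewrite mxE mx_consSS.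
by move=> M /and3P[/eqP MT /forallP M0 _]; apply: mx_cons_eta => //; apply/eqP/M0.
Qed.

Lemma R_stat_cons m u (M : 'M_m) :
  R_stat (int_mx (mx_cons u M))
  = (count (fun x => x != 0%R) (entry_seq u) + R_stat (int_mx M))%N.
Proof.
have absE (e : asm_entry) : `|ssval e|%N = (ssval e != 0).
  by have := asm_entry_in e; rewrite !inE => /or3P[]/eqP->.
rewrite /R_stat big_ord_recl; congr (_ + _)%N.
  rewrite big_mkcond big_ord_recl /= add0n -sum1_count big_map.
  rewrite [RHS]big_mkcond big_enum /=; apply: eq_bigr => j _.
  by rewrite mxE mx_cons0S absE; case: (_ != _).
apply: eq_bigr => i _.
rewrite [LHS]big_mkcond big_ord_recl /= add0n [RHS]big_mkcond /=.
by apply: eq_bigr => j _; rewrite !mxE !liftK.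
Qed.

Lemma asm_row_single us : asm_row false us ->
  asm_step (nseq (size us) false) us ->
  [/\ (index 1%R us < size us)%N, count (fun x => x != 0) us = 1%N
    & forall j, nth 0 us j = 1 -> j = index 1 us].
Proof.
have zeros vs : asm_row true vs -> asm_step (nseq (size vs) false) vs ->
    vs = nseq (size vs) 0.
  elim: vs => [|v vs IH] //=; case: eqP => [->|_] /=.
    by move=> /IH vsE /vsE {1}->.
  by move=> /andP[/eqP-> _].
elim: us => [|u us IH] //=; case: eqP => [->|_] /=.
  move=> /IH {}IH /IH[lt_us ct_us idx]; split=> //; case=> [|j] //= /idx -> //.
move=> /andP[/eqP -> us1] /= /(zeros _ us1) ->.
by split; rewrite ?size_nseq ?count_nseq // => -[|j] //=; rewrite nth_nseq if_same.
Qed.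

(** The offset 2 accounts for the diagonal zero and for counting columns from 1. *)
Lemma T_stat_cons m (u : {ffun 'I_m -> asm_entry}) (M : 'M_m) :
  asm_row false (entry_seq u) -> asm_step (nseq m false) (entry_seq u) ->
  T_stat (int_mx (mx_cons u M)) = (index 1 (entry_seq u)).+2.
Proof.
have sz : size (entry_seq u) = m by rewrite size_ord_seq.
move=> u_row u_step; have := asm_row_single u_row; rewrite sz => /(_ u_step).
have intE i j : int_mx (mx_cons u M) i j = ssval (mx_cons u M i j) by rewrite mxE.
case=> lt_m _ idx; rewrite /T_stat; case: pickP => [j /existsP[i]|none].
  case/andP=> /eqP i0; rewrite (_ : i = ord0); last exact/val_inj.
  case: (unliftP ord0 j) => [j'|] ->; rewrite intE ?mx_cons00 ?mx_cons0S //.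
  by move=> /eqP uj; rewrite /= -(idx j') // nth_ord_seq.
have := none (lift ord0 (Ordinal lt_m)); case/existsP; exists ord0 => /=.
rewrite intE mx_cons0S -[ssval _](nth_ord_seq (fun j => ssval (u j)) 0) /=.
by rewrite nth_index // -index_mem sz.
Qed.

(** * The partition function as a generating function of OSASMs *)

Lemma pf_unif (R : comNzRingType) (A B r : R) m vs : A - B = 1 -> size vs = m ->
  pf A B r r (nseq m 1) vs
  = \sum_(M : 'M[asm_entry]_m | partial_osasm vs M) r ^+ R_stat (int_mx M).
Proof.
move=> AB1; elim: m vs => [|m IH] [|v vs] //= => [_|[sz]].
  rewrite (big_pred1 (const_mx entry_0)) => [|M].
    by rewrite /R_stat big_ord0.
  have -> : M = const_mx entry_0 by apply/matrixP => -[].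
  rewrite /= eqxx.
  by apply/and3P; split; [apply/eqP/matrixP | apply/forallP | apply/forallP] => -[].
rewrite row_sum // sum_partial_osasm // [RHS]big_mkcond /=.
apply: eq_bigr => u _; rewrite row_wgt_unif ?size_ord_seq //.
case: ifP => _; last by rewrite mul0r.
rewrite IH; last by rewrite size_map size_zip size_ord_seq sz minnn.
by rewrite big_distrr; apply: eq_bigr => M _ /=; rewrite R_stat_cons exprD.
Qed.

Lemma pf0_osasm (R : comNzRingType) (A B r x : R) m : A - B = 1 ->
  pf0 A B r r (x :: nseq m 1)
  = \sum_(M : 'M[asm_entry]_m.+1 | is_osasm (int_mx M))
      r ^+ R_stat (int_mx M) * (wgt_a A B x ^+ (T_stat (int_mx M) - 2)
                                * wgt_b A B x ^+ (m.+1 - T_stat (int_mx M))).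
Proof.
move=> AB1; under [RHS]eq_bigl do rewrite is_osasmE.
rewrite -[nseq m.+1 false]/(false :: nseq m false).
rewrite sum_partial_osasm ?size_nseq // /pf0 /= size_nseq.
rewrite row_sum ?size_nseq // [RHS]big_mkcond /=; apply: eq_bigr => u _.
have sz : size (entry_seq u) = m by rewrite size_ord_seq.
have := row_wgt_first A B r r x (entry_seq u); rewrite sz => ->.
case: ifP => [/andP[u_row u_step]|]; last first.
  by rewrite mul0r.
have := asm_row_single u_row; rewrite sz => /(_ u_step)[_ ct_u _].
rewrite pf_unif //; last by rewrite size_map size_zip sz size_nseq minnn.
rewrite big_distrr; apply: eq_bigr => M _ /=.
rewrite R_stat_cons T_stat_cons // ct_u exprS subn2 subSS -subn1 -subnDA add1n.
by move: (wgt_a A B x ^+ _) (wgt_b A B x ^+ _) (r ^+ _) => a b c; ring.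
Qed.

(** * Symmetry at numerical values *)

Lemma T_stat_bounds m (M : 'M[asm_entry]_m.+1) :
  is_osasm (int_mx M) -> (1 < T_stat (int_mx M) <= m.+1)%N.
Proof.
rewrite is_osasmE => oM; have /and3P[/eqP MT /forallP M0 _] := oM.
have := oM; rewrite -(mx_cons_eta MT (eqP (M0 ord0))).
rewrite -[nseq m.+1 false]/(false :: nseq m false).
rewrite partial_osasm_cons ?size_nseq // => /andP[/andP[u_row u_step] _].
rewrite T_stat_cons //= ltnS.
by have := asm_row_single u_row; rewrite size_ord_seq => /(_ u_step)[].
Qed.

Lemma osasm_sum_sym (K : fieldType) (A B r t : K) m :
  odd m -> A - B = 1 -> A != 0 -> B != 0 -> A + B != 0 -> A + t * B != 0 ->
  A * B * (r * r) = (A ^+ 2 - B ^+ 2) ^+ 2 ->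
  \sum_(M : 'M[asm_entry]_m.+1 | is_osasm (int_mx M))
     r ^+ R_stat (int_mx M) * t ^+ T_stat (int_mx M)
  = \sum_(M : 'M[asm_entry]_m.+1 | is_osasm (int_mx M))
     r ^+ R_stat (int_mx M) * t ^+ (m.+3 - T_stat (int_mx M)).
Proof.
move=> odd_m AB1 A0 B0 AB0 AtB0 rel.
(* The solution of [wgt_a A B x = t * wgt_b A B x]. *)
pose x := (t * A + B) / (A + t * B).
have AB2 : A ^+ 2 - B ^+ 2 = A + B by rewrite subr_sqr AB1 mul1r.
have bE : wgt_b A B x = (A + B) / (A + t * B).
  by rewrite -AB2 /wgt_b /x; field.
have aE : wgt_a A B x = t * wgt_b A B x.
  by rewrite /wgt_a /wgt_b /x; field.
have b0 : wgt_b A B x != 0 by rewrite bE mulf_neq0 ?invr_eq0.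
have aE' : wgt_a (- B) (- A) x = wgt_b A B x by rewrite /wgt_a /wgt_b; ring.
have bE' : wgt_b (- B) (- A) x = wgt_a A B x by rewrite /wgt_a /wgt_b; ring.
have := pf0_dual_ones x rel A0 B0 odd_m.
rewrite !pf0_osasm ?opprK 1?[_ + A]addrC // aE' bE' aE.
(* As [a = t * b], both sides contain [b ^+ m.-1], next to [t ^+ (T - 2)] and [t ^+ (m.+1 - T)]; the
   factor [t ^+ 2] restores the exponents. *)
move/(congr1 (fun y => y / wgt_b A B x ^+ m.-1 * t ^+ 2)).
have m_gt0 : (0 < m)%N by case: (m) odd_m.
have cancel (c y1 y2 y3 y4 : K) : y1 != 0 -> y2 != 0 ->
    c * (y3 * y1 * y2) / (y1 * y2) * y4 = c * (y3 * y4).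
  by move=> y1_n0 y2_n0; field; rewrite y1_n0 y2_n0.
rewrite !mulr_suml; congr (_ = _); apply: eq_bigr => M oM;
  have /andP[T2 Tm] := T_stat_bounds oM; rewrite exprMn;
  set T := T_stat _ in T2 Tm *; set b := wgt_b A B x in b0 *;
  have -> : m.-1 = (T - 2 + (m.+1 - T))%N by lia.
- have -> : t ^+ T = t ^+ (T - 2) * t ^+ 2 by rewrite -exprD subnK.
  by rewrite exprD cancel ?expf_neq0.
- have -> : (m.+3 - T)%N = (m.+1 - T + 2)%N by lia.
  rewrite !exprD [b ^+ _ * (_ * _)]mulrCA [t ^+ _ * (_ * _)]mulrA.
  by rewrite cancel ?expf_neq0.
Qed.

(** * From numerical values to Laurent polynomials *)

Lemma poly_eq0_inj (D : idomainType) (p : {poly D}) (f : nat -> D) :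
  injective f -> (forall k, p.[f k] = 0) -> p = 0.
Proof.
move=> f_inj fp0; apply/eqP/negPn/negP => p0.
have rootf : all (root p) (map f (iota 0 (size p))).
  by apply/allP => _ /mapP[k _ ->]; apply/rootP.
have := max_poly_roots p0 rootf.
by rewrite map_inj_uniq // iota_uniq size_map size_iota ltnn => /(_ isT).
Qed.

(** Taking [r > 2] and [t > 0] allows positive [A] and [B], which settles all nonvanishing
    conditions at once. *)
Lemma osasm_sum_sym_algC m (k l : nat) : odd m ->
  let r := (k + 3)%:R : algC in let t := l.+1%:R : algC in
  \sum_(M : 'M[asm_entry]_m.+1 | is_osasm (int_mx M))
     r ^+ R_stat (int_mx M) * t ^+ T_stat (int_mx M)
  = \sum_(M : 'M[asm_entry]_m.+1 | is_osasm (int_mx M))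
     r ^+ R_stat (int_mx M) * t ^+ (m.+3 - T_stat (int_mx M)).
Proof.
move=> odd_m r t.
have r_gt2 : 2 < r by rewrite ltr_nat leq_addl.
have r_gt0 : 0 < r by apply: lt_trans r_gt2; rewrite ltr0n.
have r24 : 0 < r ^+ 2 - 4.
  rewrite subr_gt0 (_ : 4 = 2 ^+ 2 :> algC); last by rewrite -natrX.
  by rewrite ltr_pXn2r ?nnegrE ?ler0n // ltW.
(* With [A - B = 1], the relation reads [A * B * (r ^+ 2 - 4) = 1]. *)
pose s := sqrtC (r ^+ 2 - 4).
have s_gt0 : 0 < s by rewrite sqrtC_gt0.
have s2 : s ^+ 2 = r ^+ 2 - 4 by rewrite sqrtCK.
have sr : s < r.
  by rewrite -(@ltr_pXn2r _ 2) ?nnegrE ?ltW // s2 gtrDl oppr_lt0 ltr0n.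
(* The positive root of [B * (B + 1) * s ^+ 2 = 1]; its discriminant [1 + 4 / s ^+ 2] is the square
   of [r / s]. *)
pose B := (r / s - 1) / 2; pose A := B + 1.
have B_gt0 : 0 < B.
  by rewrite divr_gt0 ?ltr0n // subr_gt0 ltr_pdivlMr // mul1r.
have A_gt0 : 0 < A by rewrite addr_gt0.
have AB1 : A - B = 1 by rewrite /A addrAC subrr add0r.
have s0 : s != 0 by rewrite gt_eqF.
have rel : A * B * (r * r) = (A ^+ 2 - B ^+ 2) ^+ 2.
  have r2 : r * r = s ^+ 2 + 4 by rewrite s2 subrK expr2.
  have -> : A * B * (r * r) = (r * r / s ^+ 2 - 1) / 4 * (r * r).
    by rewrite /A /B; field.
  have -> : (A ^+ 2 - B ^+ 2) ^+ 2 = r * r / s ^+ 2 by rewrite /A /B; field.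
  by rewrite r2; field.
clearbody A B.
by apply: osasm_sum_sym odd_m AB1 _ _ _ _ rel;
  rewrite gt_eqF ?addr_gt0 ?mulr_gt0 ?ltr0Sn.
Qed.

Lemma osasm_poly_sym m : odd m ->
  \sum_(M : 'M[asm_entry]_m.+1 | is_osasm (int_mx M))
     ('X%:P : {poly {poly int}}) ^+ R_stat (int_mx M) * 'X ^+ T_stat (int_mx M)
  = \sum_(M : 'M[asm_entry]_m.+1 | is_osasm (int_mx M))
     'X%:P ^+ R_stat (int_mx M) * 'X ^+ (m.+3 - T_stat (int_mx M)).
Proof.
move=> odd_m; apply/eqP; rewrite -subr_eq0; apply/eqP.
have intr_inj_nat c : injective (fun k => (k + c)%:R : int).
  by move=> i j /eqP; rewrite eqr_nat eqn_add2r => /eqP.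
have evalE k l (e : 'M[asm_entry]_m.+1 -> nat) :
    ((\sum_(M : 'M[asm_entry]_m.+1 | is_osasm (int_mx M))
     ('X%:P : {poly {poly int}}) ^+ R_stat (int_mx M) * 'X ^+ e M
       ).[((l + 1)%:R : int)%:P]).[(k + 3)%:R]%:~R
  = \sum_(M : 'M[asm_entry]_m.+1 | is_osasm (int_mx M))
     (k + 3)%:R ^+ R_stat (int_mx M) * l.+1%:R ^+ e M :> algC.
  rewrite !horner_sum rmorph_sum; apply: eq_bigr => M _ /=.
  rewrite hornerM !horner_exp hornerC hornerX hornerM !horner_exp hornerX hornerC.
  by rewrite rmorphM !rmorphXn !rmorph_nat addn1.
(* First the outer variable [t] runs through the positive integers, then [r] through those from 3
   on. *)
apply: (poly_eq0_inj (f := fun l => ((l + 1)%:R : int)%:P)) => [i j /polyC_inj|l].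
  exact: intr_inj_nat.
apply: (poly_eq0_inj (intr_inj_nat 3%N)) => k.
apply/(@intr_inj algC); rewrite !hornerD !hornerN rmorphB /= !evalE.
by rewrite osasm_sum_sym_algC // subrr.
Qed.

Lemma X_O_frac (N m : nat) (e : 'M[asm_entry]_N -> nat) :
  \sum_(M : 'M[asm_entry]_N | is_osasm (int_mx M))
     indet_r ^+ R_stat (int_mx M) * indet_t ^+ e M
  = tofrac (\sum_(M : 'M[asm_entry]_N | is_osasm (int_mx M))
     ('X%:P : {poly {poly int}}) ^+ R_stat (int_mx M) * 'X ^+ e M).
Proof.
rewrite rmorph_sum; apply: eq_bigr => M _ /=.
by rewrite rmorphM !rmorphXn.
Qed.

Unset Implicit Arguments.

Theorem theorem5p1 (n : nat) (hn : (1 <= n)%N) :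
  X_O n indet_r indet_t =
  indet_t ^+ (2 * n + 2) * X_O n indet_r (indet_t^-1).
Proof.
have t0 : indet_t != 0 by rewrite tofrac_eq0 polyX_eq0.
rewrite /X_O /OSASM; under eq_bigl do rewrite inE.
under [in RHS]eq_bigl do rewrite inE.
have {hn} : (0 < 2 * n)%N && ~~ odd (2 * n).
  by rewrite muln_gt0 hn oddM.
case: (2 * n)%N => [//|m] /andP[_ /=]; rewrite negbK => odd_m.
(* With the exponents [m.+3 - T] the symmetry is one of polynomials; [T <= m.+1] then makes them
   equal to [t ^+ m.+3] times the inverse power. *)
rewrite X_O_frac // osasm_poly_sym // -X_O_frac // big_distrr /=.
apply: eq_bigr => M oM; have /andP[_ Tm] := T_stat_bounds oM.
rewrite mulrCA; congr (_ * _).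
rewrite -[(m.+1 + 2)%N](@subnK (T_stat (int_mx M))); last by lia.
by rewrite exprD exprVn mulfK ?expf_neq0 // addn2.
Qed.
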